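(* Let $(\mathbb G,\mathcal E)$ be a linear algebraic group of exponential type, and for $d\ge 0$ let $$\mathcal E(\mathbb G)_d\ \equiv\ (\mathcal E^{*})^{-1}\big(k[\mathcal N_p(\mathfrak g)][t]_{\leq d}\big)\ \subset\ \mathcal O(\mathbb G),$$ where $k[\mathcal N_p(\mathfrak g)][t]_{\leq d}\subset k[\mathcal N_p(\mathfrak g)\times\mathbb G_a]=k[\mathcal N_p(\mathfrak g)][t]$ is the subspace of polynomials in $t$ of degree $\leq d$. Then for every $\mathbb G$-module $M$, $\{M_{\mathcal E(\mathbb G)_d}\}$ is the coarsest filtration of $M$ by $\mathbb G$-submodules subordinate to the filtration $\{M_{[d]}\}$ of $M$ by exponential degree. Moreover, $M_{\mathcal E(\mathbb G)_d}\otimes N_{\mathcal E(\mathbb G)_e}\subset (M\otimes N)_{\mathcal E(\mathbb G)_{d+e}}$ for every pair of $\mathbb G$-modules $M,N$ (and all $d,e\geq 0$).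
   Context: $k$ is a field of characteristic $p>0$; a linear algebraic group is a smooth connected affine group scheme of finite type over $k$. A $\mathbb G$-module $M$ is a right $\mathcal O(\mathbb G)$-comodule with coaction $\Delta_M:M\to M\otimes\mathcal O(\mathbb G)$. For a subspace $X\subset\mathcal O(\mathbb G)$, $M_X\subset M$ is the largest $\mathbb G$-submodule $N\subset M$ with $\Delta_N(N)\subset N\otimes X$. Filtration by exponential degree: $M_{[d]}=\{m\in M:\Delta_M(m)\in M\otimes\mathcal E(\mathbb G)_d\}$, a $k$-subspace of $M$ that need not be a $\mathbb G$-submodule. A filtration $\{M_d\}$ of $M$ by $\mathbb G$-submodules is subordinate to $\{M_{[d]}\}$ if $M_d\subset M_{[d]}$ for all $d$; it is the coarsest such filtration if any other such filtration $\{M'_d\}$ satisfies $M'_d\subset M_d$ for all $d$. Exponential type: let $\mathfrak g=Lie(\mathbb G)$. $\mathcal N_p(\mathfrak g)\subset\mathfrak g$ is the reduced closed subvariety whose $K$-points are the $B\in\mathfrak g_K$ with $B^{[p]}=0$, and $\mathcal C_r(\mathcal N_p(\mathfrak g))$ is the variety of $r$-tuples of pairwise commuting $p$-nilpotent elements of $\mathfrak g$. $\mathbb G_{(r)}$ denotes the $r$-th Frobenius kernel of $\mathbb G$ and $V(\mathbb G_{(r)})$ the scheme representing the functor of 1-parameter subgroups $\mathbb G_{a(r),A}\to\mathbb G_{(r),A}$ (homomorphisms of group schemes over commutative $k$-algebras $A$). A structure of exponential type on $\mathbb G$ is a $\mathbb G$-equivariant morphism of $k$-schemes (for the adjoint actions)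 $\mathcal E:\mathcal N_p(\mathfrak g)\times\mathbb G_a\to\mathbb G$, $(B,s)\mapsto\mathcal E_B(s)$, such that for all field extensions $K/k$: (1) for each $B\in\mathcal N_p(\mathfrak g)(K)$, $\mathcal E_B:\mathbb G_{a,K}\to\mathbb G_K$ is a 1-parameter subgroup (homomorphism of group schemes); (2) for commuting $p$-nilpotent $B,B'\in\mathfrak g_K$, the maps $\mathcal E_B,\mathcal E_{B'}$ commute; (3) for any $\alpha\in K$ and $s\in\mathbb G_a(K)$, $\mathcal E_{\alpha\cdot B}(s)=\mathcal E_B(\alpha\cdot s)$; (4) every 1-parameter subgroup $\psi:\mathbb G_{a,K}\to\mathbb G_K$ has the form $\mathcal E_{\underline B}=\prod_{s=0}^{r-1}(\mathcal E_{B_s}\circ F^s)$ for some $r>0$ and $\underline B=(B_0,\dots,B_{r-1})\in\mathcal C_r(\mathcal N_p(\mathfrak g_K))$, where $F$ is the Frobenius of $\mathbb G_a$; (5) the natural map $\mathcal C_r(\mathcal N_p(\mathfrak g))\to V(\mathbb G_{(r)})$ induces a bijection on $K$-points, sending $\underline B$ to the infinitesimal 1-parameter subgroup $\mathbb G_{a(r),K}\to\mathbb G_{(r),K}$ through which $\mathcal E_{\underline B}\circ i_r:\mathbb G_{a(r),K}\to\mathbb G_{a,K}\to\mathbb G_K$ factors ($i_r$ the inclusion). *)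

(* Defs.v *)
From HB Require Import structures.
From mathcomp Require Import all_boot all_order all_algebra.
From mathcomp Require Import boolp classical_sets.

Set Implicit Arguments.
Unset Strict Implicit.
Unset Printing Implicit Defensive.

Import GRing.Theory.
Local Open Scope ring_scope.
Local Open Scope classical_set_scope.
Local Open Scope quotient_scope.

(* The tensor product of k-modules, by generators and relations: formal sums
   of pure tensors (u, v) modulo the bilinearity relations. *)
Section Tensor.
Context {k : fieldType}.
Variables U V : lmodType k.

Inductive tens_eq : seq (U * V) -> seq (U * V) -> Prop :=
| tens_eq_refl s : tens_eq s s
| tens_eq_sym s t : tens_eq s t -> tens_eq t s
| tens_eq_trans s t r : tens_eq s t -> tens_eq t r -> tens_eq s r
| tens_eq_cat s s' t t' : tens_eq s s' -> tens_eq t t' ->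
    tens_eq (s ++ t) (s' ++ t')
| tens_eq_catC s t : tens_eq (s ++ t) (t ++ s)
| tens_eq_zero v : tens_eq [:: (0, v)] [::]
| tens_eq_addl u u' v : tens_eq [:: (u + u', v)] [:: (u, v); (u', v)]
| tens_eq_addr u v v' : tens_eq [:: (u, v + v')] [:: (u, v); (u, v')]
| tens_eq_scale c u v : tens_eq [:: (c *: u, v)] [:: (u, c *: v)].

Definition tens_eqb : rel (seq (U * V)) := fun s t => `[< tens_eq s t >].

Fact tens_eqb_class : equiv_class_of tens_eqb.
Proof.
split=> [s|s t|t s r].
- by apply/asboolP; exact: tens_eq_refl.
- by apply/asboolP/asboolP; exact: tens_eq_sym.
- by move=> /asboolP st /asboolP tr; apply/asboolP; exact: tens_eq_trans st tr.
Qed.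

Definition tens_equiv := EquivRelPack tens_eqb_class.

Definition tensor := {eq_quot tens_equiv}.

HB.instance Definition _ := Choice.on tensor.

Lemma tens_piP s t : tens_eq s t <-> \pi_tensor s = \pi_tensor t.
Proof.
split=> [st|/eqmodP/asboolP //]; apply/eqmodP; exact/asboolP.
Qed.

Lemma tens_reprP s : tens_eq (repr (\pi_tensor s)) s.
Proof. by apply/tens_piP; rewrite reprK. Qed.

Definition tens (u : U) (v : V) : tensor := \pi_tensor [:: (u, v)].

Definition tens_add (s t : tensor) : tensor := \pi_tensor (repr s ++ repr t).

Definition tens_scale (c : k) (s : tensor) : tensor :=
  \pi_tensor [seq (c *: w.1, w.2) | w <- repr s].

Definition tens_opp (s : tensor) : tensor := tens_scale (-1) s.

Lemma tens_addE s t :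
  tens_add (\pi_tensor s) (\pi_tensor t) = \pi_tensor (s ++ t).
Proof. by apply/tens_piP/tens_eq_cat; exact: tens_reprP. Qed.

Lemma tens_eq_map c s t : tens_eq s t ->
  tens_eq [seq (c *: w.1, w.2) | w <- s] [seq (c *: w.1, w.2) | w <- t].
Proof.
elim=> {s t} [s|s t _|s t r _ IH _|s s' t t' _ IH _|s t|v|u u' v|u v v'|d u v] /=.
- exact: tens_eq_refl.
- exact: tens_eq_sym.
- exact: tens_eq_trans IH.
- by rewrite !map_cat; exact: tens_eq_cat IH.
- by rewrite !map_cat; exact: tens_eq_catC.
- by rewrite scaler0; exact: tens_eq_zero.
- by rewrite scalerDr; exact: tens_eq_addl.
- exact: tens_eq_addr.
- by rewrite scalerA mulrC -scalerA; exact: tens_eq_scale.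
Qed.

Lemma tens_scaleE c s :
  tens_scale c (\pi_tensor s) = \pi_tensor [seq (c *: w.1, w.2) | w <- s].
Proof. by apply/tens_piP/tens_eq_map; exact: tens_reprP. Qed.

Lemma tens_rep (x : tensor) : exists s, x = \pi_tensor s.
Proof. by exists (repr x); rewrite reprK. Qed.

Fact tens_addA : associative tens_add.
Proof.
move=> x y z; have [[s ->] [t ->] [r ->]] := And3 (tens_rep x) (tens_rep y) (tens_rep z).
by rewrite !tens_addE catA.
Qed.

Fact tens_addC : commutative tens_add.
Proof.
move=> x y; have [s ->] := tens_rep x; have [t ->] := tens_rep y.
by rewrite !tens_addE; apply/tens_piP; exact: tens_eq_catC.
Qed.

Fact tens_add0 : left_id (\pi_tensor [::]) tens_add.
Proof. by move=> x; have [s ->] := tens_rep x; rewrite tens_addE. Qed.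

Fact tens_scaleDl_subproof (c d : k) s :
  tens_eq [seq ((c + d) *: w.1, w.2) | w <- s]
    ([seq (c *: w.1, w.2) | w <- s] ++ [seq (d *: w.1, w.2) | w <- s]).
Proof.
elim: s => [|[u v] s IH] /=; first exact: tens_eq_refl.
rewrite scalerDl -cat1s; apply: (tens_eq_trans (tens_eq_cat (tens_eq_addl _ _ _) IH)).
rewrite /= -[(c *: u, v) :: _]cat1s -[(c *: u, v) :: _ ++ _]cat1s.
apply: tens_eq_cat; first exact: tens_eq_refl.
rewrite -[(d *: u, v) :: _]cat1s -[(d *: u, v) :: map _ _]cat1s !catA.
by apply: tens_eq_cat; [exact: tens_eq_catC|exact: tens_eq_refl].
Qed.

Fact tens_scaleDl (s : tensor) :
  {morph tens_scale^~ s : c d / c + d >-> tens_add c d}.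
Proof.
move=> c d; have [{}s ->] := tens_rep s; rewrite !tens_scaleE tens_addE.
exact/tens_piP/tens_scaleDl_subproof.
Qed.

Fact tens_scale0 s : tens_scale 0 s = \pi_tensor [::].
Proof.
have [{}s ->] := tens_rep s; rewrite tens_scaleE; apply/tens_piP.
elim: s => [|[u v] s IH] /=; first exact: tens_eq_refl.
by rewrite scale0r -cat1s; exact: (tens_eq_cat (tens_eq_zero v) IH).
Qed.

Fact tens_scale1 : left_id 1 tens_scale.
Proof.
move=> s; have [{}s ->] := tens_rep s; rewrite tens_scaleE; congr (\pi_tensor _).
by elim: s => //= -[u v] s ->; rewrite scale1r.
Qed.

Fact tens_addN : left_inverse (\pi_tensor [::]) tens_opp tens_add.
Proof.
move=> s; rewrite -[X in tens_add _ X]tens_scale1 /tens_opp -tens_scaleDl.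
by rewrite addNr tens_scale0.
Qed.

HB.instance Definition _ :=
  GRing.isZmodule.Build tensor tens_addA tens_addC tens_add0 tens_addN.

Fact tens_scaleA c d s : tens_scale c (tens_scale d s) = tens_scale (c * d) s.
Proof.
have [{}s ->] := tens_rep s; rewrite !tens_scaleE -map_comp; congr (\pi_tensor _).
by apply: eq_map => w /=; rewrite scalerA.
Qed.

Fact tens_scaleDr : right_distributive tens_scale +%R.
Proof.
move=> c x y; have [s ->] := tens_rep x; have [t ->] := tens_rep y.
by rewrite [_ + _]tens_addE !tens_scaleE [RHS]tens_addE map_cat.
Qed.

HB.instance Definition _ := GRing.Zmodule_isLmodule.Build k tensor
  tens_scaleA tens_scale1 tens_scaleDr tens_scaleDl.

Lemma tens_piE s : \pi_tensor s = \sum_(w <- s) tens w.1 w.2.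
Proof.
elim: s => [|[u v] s IH]; first by rewrite big_nil.
by rewrite big_cons -IH /= [RHS]tens_addE.
Qed.

Lemma tensDl u u' v : tens (u + u') v = tens u v + tens u' v.
Proof. by rewrite [RHS]tens_addE; apply/tens_piP; exact: tens_eq_addl. Qed.

Lemma tensDr u v v' : tens u (v + v') = tens u v + tens u v'.
Proof. by rewrite [RHS]tens_addE; apply/tens_piP; exact: tens_eq_addr. Qed.

Lemma tensZl c u v : tens (c *: u) v = c *: tens u v.
Proof. by rewrite [RHS]tens_scaleE. Qed.

Lemma tensZr c u v : tens u (c *: v) = c *: tens u v.
Proof.
by rewrite -tensZl; apply/tens_piP/tens_eq_sym; exact: tens_eq_scale.
Qed.

Lemma tens_ind (P : tensor -> Prop) :
  P 0 -> (forall u v, P (tens u v)) ->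
  (forall x y, P x -> P y -> P (x + y)) -> forall x, P x.
Proof.
move=> P0 P1 PD x; have [s ->] := tens_rep x; rewrite tens_piE.
by elim/big_ind: _.
Qed.

(* The map tensor U V -> W induced by b : U -> V -> W; it is only meaningful
   when b is balanced in the sense of the predicate below. *)
Definition tens_lift (W : zmodType) (b : U -> V -> W) (t : tensor) : W :=
  \sum_(w <- repr t) b w.1 w.2.

Definition balanced (W : zmodType) (b : U -> V -> W) : Prop :=
  [/\ forall u u' v, b (u + u') v = b u v + b u' v,
      forall u v v', b u (v + v') = b u v + b u v'
    & forall c u v, b (c *: u) v = b u (c *: v)].

Lemma tens_lift_pi (W : zmodType) (b : U -> V -> W) s : balanced b ->
  tens_lift b (\pi_tensor s) = \sum_(w <- s) b w.1 w.2.
Proof.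
move=> [bl br bc]; rewrite /tens_lift.
have: tens_eq (repr (\pi_tensor s)) s by exact: tens_reprP.
move: (repr _) => r.
elim=> {s r} [//|s t _ -> //|s t r _ -> _ -> //|s s' t t' _ IH _ IH'|s t|v|u u' v|u v v'|d u v].
- by rewrite !big_cat /= IH IH'.
- by rewrite !big_cat /= addrC.
- rewrite big_seq1 big_nil /=.
  by apply: (addrI (b 0 v)); rewrite -bl !addr0.
- by rewrite !big_cons !big_nil /= !addr0 bl.
- by rewrite !big_cons !big_nil /= !addr0 br.
- by rewrite !big_seq1 /= bc.
Qed.

Lemma tens_lift_tens (W : zmodType) (b : U -> V -> W) u v : balanced b ->
  tens_lift b (tens u v) = b u v.
Proof. by move=> bb; rewrite tens_lift_pi // big_seq1. Qed.

Lemma tens_lift0 (W : zmodType) (b : U -> V -> W) : balanced b ->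
  tens_lift b 0 = 0.
Proof. by move=> bb; rewrite tens_lift_pi // big_nil. Qed.

Lemma tens_liftD (W : zmodType) (b : U -> V -> W) x y : balanced b ->
  tens_lift b (x + y) = tens_lift b x + tens_lift b y.
Proof.
move=> bb; have [s ->] := tens_rep x; have [t ->] := tens_rep y.
by rewrite [_ + _]tens_addE !tens_lift_pi // big_cat.
Qed.

Lemma tens_liftZ (W : lmodType k) (b : U -> V -> W) c x : balanced b ->
  (forall u v, b (c *: u) v = c *: b u v) ->
  tens_lift b (c *: x) = c *: tens_lift b x.
Proof.
move=> bb bZ; elim/tens_ind: x => [|u v|x y IH IH'].
- by rewrite scaler0 tens_lift0 // scaler0.
- by rewrite -tensZl !tens_lift_tens.
- by rewrite scalerDr !tens_liftD // scalerDr IH IH'.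
Qed.

(* For subspaces N and X, this is N (x) X inside U (x) V. *)
Definition tens_sub (N : set U) (X : set V) : set tensor :=
  [set t | exists2 s : seq (U * V),
     (forall w, w \in s -> N w.1 /\ X w.2) & t = \sum_(w <- s) tens w.1 w.2].

End Tensor.

Notation "u ⊗ v" := (tens u v) (at level 40, left associativity) : ring_scope.

Section TensorMaps.
Context {k : fieldType}.

Definition bilin (U V W : lmodType k) (b : U -> V -> W) : Prop :=
  (forall v, linear (b^~ v)) /\ (forall u, linear (b u)).

Definition tens_map (U V U' V' : lmodType k) (f : U -> U') (g : V -> V') :
  tensor U V -> tensor U' V' := tens_lift (fun u v => f u ⊗ g v).

Definition tens_assoc (U V W : lmodType k) :
  tensor (tensor U V) W -> tensor U (tensor V W) :=
  tens_lift (fun t w => tens_lift (fun u v => u ⊗ (v ⊗ w)) t).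

(* (u ⊗ v, u' ⊗ v') |-> b u u' ⊗ c v v' *)
Definition tens_pair (U V U' V' P Q : lmodType k)
    (b : U -> U' -> P) (c : V -> V' -> Q)
    (x : tensor U V) (y : tensor U' V') : tensor P Q :=
  tens_lift (fun u v => tens_lift (fun u' v' => b u u' ⊗ c v v') y) x.

Definition tens_mul (A B : comAlgType k) (x y : tensor A B) : tensor A B :=
  tens_pair *%R *%R x y.

Lemma bilin_balanced (U V W : lmodType k) (b : U -> V -> W) :
  bilin b -> balanced b.
Proof.
move=> [bl br].
have b0l v : b 0 v = 0 by have := bl v (-1) 0 0; rewrite scaleN1r addNr scaleN1r addNr.
have b0r u : b u 0 = 0 by have := br u (-1) 0 0; rewrite scaleN1r addNr scaleN1r addNr.
split=> [u u' v|u v v'|c u v].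
- by have := bl v 1 u u'; rewrite !scale1r.
- by have := br u 1 v v'; rewrite !scale1r.
- have := bl v c u 0; rewrite b0l !addr0 => ->.
  by have := br u c v 0; rewrite b0r !addr0 => ->.
Qed.

Lemma tens_lift_lin (U V W : lmodType k) (b : U -> V -> W) :
  bilin b -> linear (tens_lift b).
Proof.
move=> bb a x y; have bal := bilin_balanced bb.
rewrite tens_liftD // tens_liftZ // => u v.
have := bb.1 v a u 0; rewrite addr0 => ->.
by have := bb.1 v (-1) u u; rewrite scaleN1r addNr scaleN1r addNr => ->; rewrite addr0.
Qed.

Lemma tens_liftE (U V W : lmodType k) (b : U -> V -> W) u v :
  bilin b -> tens_lift b (u ⊗ v) = b u v.
Proof. by move=> /bilin_balanced; exact: tens_lift_tens. Qed.

Lemma tens_lift_comb (U V W : lmodType k) (b b' b'' : U -> V -> W) a x :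
  (forall u v, b'' u v = a *: b u v + b' u v) ->
  tens_lift b'' x = a *: tens_lift b x + tens_lift b' x.
Proof.
by move=> E; rewrite /tens_lift scaler_sumr -big_split; apply: eq_bigr.
Qed.

Lemma eq_linear_tens (U V W : lmodType k) (f g : tensor U V -> W) :
  linear f -> linear g -> (forall u v, f (u ⊗ v) = g (u ⊗ v)) -> f =1 g.
Proof.
move=> fl gl fg; elim/(@tens_ind k) => [|//|x y IH IH'].
  have := fl (-1) 0 0; have := gl (-1) 0 0.
  by rewrite !scaleN1r !addNr => -> ->.
by have := fl 1 x y; have := gl 1 x y; rewrite !scale1r => -> ->; rewrite IH IH'.
Qed.

Lemma linear_comp (U V W : lmodType k) (f : V -> W) (g : U -> V) :
  linear f -> linear g -> linear (f \o g).
Proof. by move=> fl gl a x y /=; rewrite gl fl. Qed.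

Lemma bilin_comp (U V W U' V' W' : lmodType k) (b : U -> V -> W)
    (f : U' -> U) (g : V' -> V) (h : W -> W') :
  bilin b -> linear f -> linear g -> linear h ->
  bilin (fun u v => h (b (f u) (g v))).
Proof.
move=> [bl br] fl gl hl; split=> w a x y; first by rewrite fl bl hl.
by rewrite gl br hl.
Qed.

Lemma linear_id (U : lmodType k) : linear (@id U).
Proof. by []. Qed.

Lemma tens_bilin (U V : lmodType k) : bilin (@tens k U V).
Proof.
split=> w a x y; first by rewrite tensDl tensZl.
by rewrite tensDr tensZr.
Qed.

Lemma mul_bilin (A : comAlgType k) : bilin (@GRing.mul A).
Proof.
split=> w a x y; first by rewrite mulrDl scalerAl.
by rewrite mulrDr scalerAr.
Qed.

Lemma tens_map_bilin (U V U' V' : lmodType k) (f : U -> U') (g : V -> V') :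
  linear f -> linear g -> bilin (fun u v => f u ⊗ g v).
Proof. by move=> fl gl; exact: bilin_comp (tens_bilin _ _) fl gl (@linear_id _). Qed.

Lemma tens_map_lin (U V U' V' : lmodType k) (f : U -> U') (g : V -> V') :
  linear f -> linear g -> linear (tens_map f g).
Proof. by move=> fl gl; exact/tens_lift_lin/tens_map_bilin. Qed.

Lemma tens_mapE (U V U' V' : lmodType k) (f : U -> U') (g : V -> V') u v :
  linear f -> linear g -> tens_map f g (u ⊗ v) = f u ⊗ g v.
Proof. by move=> fl gl; exact/tens_liftE/tens_map_bilin. Qed.

Lemma assoc_in_bilin (U V W : lmodType k) (w : W) :
  bilin (fun (u : U) (v : V) => u ⊗ (v ⊗ w)).
Proof.
exact: (bilin_comp (tens_bilin _ _) (@linear_id _) ((tens_bilin V W).1 w)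
  (@linear_id _)).
Qed.

Lemma assoc_bilin (U V W : lmodType k) :
  bilin (fun (t : tensor U V) (w : W) => tens_lift (fun u v => u ⊗ (v ⊗ w)) t).
Proof.
split=> [w|t a x y]; first exact/tens_lift_lin/assoc_in_bilin.
by apply: tens_lift_comb => u v; rewrite tensDr tensZr tensDr tensZr.
Qed.

Lemma tens_assoc_lin (U V W : lmodType k) : linear (@tens_assoc U V W).
Proof. exact/tens_lift_lin/assoc_bilin. Qed.

Lemma tens_assocE (U V W : lmodType k) (u : U) (v : V) (w : W) :
  tens_assoc (u ⊗ v ⊗ w) = u ⊗ (v ⊗ w).
Proof.
rewrite /tens_assoc tens_liftE; last exact: assoc_bilin.
by rewrite tens_liftE //; exact: assoc_in_bilin.
Qed.

Section Pair.
Variables (U V U' V' P Q : lmodType k) (b : U -> U' -> P) (c : V -> V' -> Q).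
Hypotheses (bb : bilin b) (bc : bilin c).

Let inner u v : bilin (fun u' v' => b u u' ⊗ c v v').
Proof. by apply: tens_map_bilin; [exact: bb.2|exact: bc.2]. Qed.

Let outer y : bilin (fun u v => tens_lift (fun u' v' => b u u' ⊗ c v v') y).
Proof.
by split=> w a x z; apply: tens_lift_comb => u' v';
  rewrite ?(bb.1) ?(bc.1) ?tensDl ?tensZl ?tensDr ?tensZr.
Qed.

Lemma tens_pair_bilin : bilin (tens_pair b c).
Proof.
split=> [y|x a y z]; first exact/tens_lift_lin/outer.
by apply: tens_lift_comb => u v; exact: tens_lift_lin.
Qed.

Lemma tens_pairE u v u' v' :
  tens_pair b c (u ⊗ v) (u' ⊗ v') = b u u' ⊗ c v v'.
Proof. by rewrite /tens_pair !tens_liftE. Qed.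

End Pair.

Lemma tens_mul_bilin (A B : comAlgType k) : bilin (@tens_mul A B).
Proof. exact: tens_pair_bilin (mul_bilin A) (mul_bilin B). Qed.

Lemma eq_bilin_tens (U V U' V' W : lmodType k)
    (f g : tensor U V -> tensor U' V' -> W) :
  bilin f -> bilin g ->
  (forall u v u' v', f (u ⊗ v) (u' ⊗ v') = g (u ⊗ v) (u' ⊗ v')) ->
  forall x y, f x y = g x y.
Proof.
move=> [f1 f2] [g1 g2] fg x y.
apply: (eq_linear_tens (f1 y) (g1 y)) => u v.
by apply: (eq_linear_tens (f2 _) (g2 _)) => u' v'.
Qed.

End TensorMaps.

(* An affine group scheme over k, given by its coordinate Hopf algebra. *)
Record affine_group (k : fieldType) := AffineGroup {
  coord :> comAlgType k;
  comul : {linear coord -> tensor coord coord};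
  counit : {lrmorphism coord -> k^o};
  antipode : {lrmorphism coord -> coord};
  comul1 : comul 1 = 1 ⊗ 1;
  comulM : forall f g, comul (f * g) = tens_mul (comul f) (comul g);
  comulA : forall f,
    tens_assoc (tens_map comul id (comul f)) = tens_map id comul (comul f);
  counitL : forall f, tens_lift (fun g h => counit g *: h) (comul f) = f;
  counitR : forall f, tens_lift (fun g h => counit h *: g) (comul f) = f;
  antipodeL : forall f,
    tens_lift (fun g h => antipode g * h) (comul f) = (counit f)%:A;
  antipodeR : forall f,
    tens_lift (fun g h => g * antipode h) (comul f) = (counit f)%:A
}.

Section LinearAlgebraicGroup.
Variable k : fieldType.

Definition generates (X : comAlgType k) (S : set X) : Prop :=
  forall P : set X, (forall c : k, P c%:A) ->
    (forall x y, P x -> P y -> P (x + y)) ->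
    (forall x y, P x -> P y -> P (x * y)) ->
    S `<=` P -> forall x, P x.

Definition finite_type (X : comAlgType k) : Prop :=
  exists s : seq X, generates [set` s].

(* The infinitesimal lifting criterion; together with finite type over the
   field k this is smoothness of Spec X over k. *)
Definition formally_smooth (X : comAlgType k) : Prop :=
  forall (A A' : comAlgType k) (pi : {lrmorphism A -> A'}),
    (forall a', exists a, pi a = a') ->
    (forall a b, pi a = 0 -> pi b = 0 -> a * b = 0) ->
    forall x : {lrmorphism X -> A'},
      exists y : {lrmorphism X -> A}, forall f, pi (y f) = x f.

Definition smooth (X : comAlgType k) : Prop :=
  finite_type X /\ formally_smooth X.

Definition prime_ideal (X : comAlgType k) (P : set X) : Prop :=
  [/\ P 0 /\ ~ P 1, forall x y, P x -> P y -> P (x + y),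
      forall x y, P y -> P (x * y)
    & forall x y, P (x * y) -> P x \/ P y].

Definition zariski_closed (X : comAlgType k) (S : set X) : set (set X) :=
  [set P | prime_ideal P /\ S `<=` P].

(* The space Spec X is connected. *)
Definition connected_spec (X : comAlgType k) : Prop :=
  forall S T : set X,
    zariski_closed S `|` zariski_closed T = [set P | prime_ideal P] ->
    zariski_closed S `&` zariski_closed T = set0 ->
    zariski_closed S = set0 \/ zariski_closed T = set0.

Definition linear_algebraic_group (G : affine_group k) : Prop :=
  smooth G /\ connected_spec G.

End LinearAlgebraicGroup.

(* Throughout, a base extension of k is a ring map iota : k -> K, and an
   A-point of Spec X, for a K-algebra A, is a k-algebra map X -> A. *)
Definition alg_point (k : fieldType) (K : comNzRingType)
    (iota : {rmorphism k -> K}) (X : comAlgType k) (A : comAlgType K)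
    (x : X -> A) : Prop :=
  [/\ zmod_morphism x, monoid_morphism x & forall c : k, x c%:A = (iota c)%:A].

(* The points of G with values in A and the elements of Lie(G) (x) A both live
   in the convolution algebra Hom_k(O(G), A); the group law, the adjoint
   action, the Lie bracket and the p-operation are computed there. *)
Section Convolution.
Variables (k : fieldType) (G : affine_group k).

Definition conv (A : comNzRingType) (x y : G -> A) : G -> A :=
  fun f => tens_lift (fun g h => x g * y h) (comul G f).

Definition conj_by (A : comNzRingType) (g x : G -> A) : G -> A :=
  conv g (conv x (g \o antipode G)).

Variables (K : comNzRingType) (iota : {rmorphism k -> K}) (A : comAlgType K).

Definition conv_one : G -> A := fun f => (iota (counit G f))%:A.

(* Elements of Lie(G) (x) A: derivations O(G) -> A over the counit. *)
Definition lie_elt (D : G -> A) : Prop :=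
  [/\ zmod_morphism D, forall c f, D (c *: f) = iota c *: D f
    & forall f g, D (f * g) = conv_one f * D g + D f * conv_one g].

Definition lie_ppow (p : nat) (D : G -> A) : G -> A :=
  iter p (conv D) conv_one.

Definition p_nilpotent (p : nat) (D : G -> A) : Prop :=
  lie_elt D /\ forall f, lie_ppow p D f = 0.

Definition lie_bracket (D D' : G -> A) : G -> A :=
  fun f => conv D D' f - conv D' D f.

(* The A-points of the r-th Frobenius kernel. *)
Definition frob_kernel_point (p r : nat) (x : G -> A) : Prop :=
  alg_point iota x /\ forall f, counit G f = 0 -> x f ^+ (p ^ r) = 0.

End Convolution.

Arguments conv_one {k} G {K} iota A.

(* The reduced closed subvariety N_p(g) of g, through its coordinate algebra
   and its tautological point.  As the coordinate algebra of g is the symmetric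
   algebra on the cotangent space of G at 1, a morphism Spec R -> g is an
   R-valued element of Lie(G), and it is a closed immersion iff the values of
   this element generate R. *)
Record pnilp_variety (p : nat) (k : fieldType) (G : affine_group k) :=
  PnilpVariety {
  np_coord :> comAlgType k;
  np_taut : G -> np_coord;
  np_taut_lie : @lie_elt k G k idfun np_coord np_taut;
  np_closed : generates (range np_taut);
  np_reduced : forall (x : np_coord) n, x ^+ n = 0 -> x = 0;
  np_points : forall (K : fieldType) (iota : {rmorphism k -> K}) (D : G -> K^o),
    (exists2 phi : np_coord -> K^o,
       alg_point iota phi & phi \o np_taut =1 D) <-> p_nilpotent iota p D
}.

(* A natural family of maps from (a subset of) A to G(A), A ranging over the
   commutative K-algebras. *)
Definition curve (k : fieldType) (G : affine_group k) (K : comNzRingType) :=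
  forall A : comAlgType K, A -> G -> A.

Section OneParameterSubgroups.
Variables (k : fieldType) (G : affine_group k).
Variables (K : fieldType) (iota : {rmorphism k -> K}).

(* Homomorphisms from G_(a,K) to G_K *)
Definition one_param_subgroup (psi : curve G K) : Prop :=
  [/\ forall (A : comAlgType K) (a : A), alg_point iota (psi A a),
      forall (A B : comAlgType K) (h : {lrmorphism A -> B}) (a : A),
        psi B (h a) =1 h \o psi A a
    & forall (A : comAlgType K) (a b : A),
        psi A (a + b) =1 conv (psi A a) (psi A b)].

(* Homomorphisms from G_(a(r),K) to G_((r),K); the values of psi A at the
   elements that are not points of G_(a(r)) are irrelevant. *)
Definition inf_one_param_subgroup (p r : nat) (psi : curve G K) : Prop :=
  [/\ forall (A : comAlgType K) (a : A), a ^+ (p ^ r) = 0 ->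
        frob_kernel_point iota p r (psi A a),
      forall (A B : comAlgType K) (h : {lrmorphism A -> B}) (a : A),
        a ^+ (p ^ r) = 0 -> psi B (h a) =1 h \o psi A a
    & forall (A : comAlgType K) (a b : A),
        a ^+ (p ^ r) = 0 -> b ^+ (p ^ r) = 0 ->
        psi A (a + b) =1 conv (psi A a) (psi A b)].

(* Equality of the restrictions to G_(a(r),K) *)
Definition inf_eq (p r : nat) (psi psi' : curve G K) : Prop :=
  forall (A : comAlgType K) (a : A), a ^+ (p ^ r) = 0 -> psi A a =1 psi' A a.

End OneParameterSubgroups.

Section ExponentialType.
Variables (p : nat) (k : fieldType) (G : affine_group k).
Variable N : pnilp_variety p G.

(* Morphisms of k-schemes N_p(g) x G_a -> G, on coordinate algebras *)
Definition exp_comorphism (e : G -> {poly N}) : Prop :=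
  [/\ zmod_morphism e, monoid_morphism e & forall c : k, e c%:A = (c%:A)%:P].

Variable e : G -> {poly N}.

(* The image in G(A) of the point (phi, s) of N_p(g) x G_a. *)
Definition exp_eval (A : comNzRingType) (phi : N -> A) (s : A) : G -> A :=
  fun f => (map_poly phi (e f)).[s].

Section Points.
Variables (K : fieldType) (iota : {rmorphism k -> K}).

Definition exp_curve (phi : N -> K^o) : curve G K :=
  fun A a => exp_eval (fun x => (phi x)%:A) a.

(* The K-points of C_r(N_p(g)), an element B of N_p(g)(K) being given by the
   corresponding k-algebra map phi, so that B = phi \o np_taut. *)
Definition commuting_tuple (r : nat) (phi : 'I_r -> N -> K^o) : Prop :=
  (forall i, alg_point iota (phi i)) /\
  (forall i j f,
     lie_bracket (phi i \o np_taut N) (phi j \o np_taut N) f = 0).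

Definition exp_tuple (r : nat) (phi : 'I_r -> N -> K^o) : curve G K :=
  fun A a => \big[@conv k G A/conv_one G iota A]_(s < r)
               exp_curve (phi s) (a ^+ (p ^ s)).

End Points.

End ExponentialType.

Record exponential_type (p : nat) (k : fieldType) (G : affine_group k)
    (N : pnilp_variety p G) := ExponentialType {
  exp_comap :> G -> {poly N};
  exp_comapP : exp_comorphism exp_comap;
  exp_equivariant : forall (A : comAlgType k) (g : G -> A) (phi phi' : N -> A)
      (s : A),
    alg_point idfun g -> alg_point idfun phi -> alg_point idfun phi' ->
    phi' \o np_taut N =1 conj_by g (phi \o np_taut N) ->
    exp_eval exp_comap phi' s =1 conj_by g (exp_eval exp_comap phi s);
  exp_one_param : forall (K : fieldType) (iota : {rmorphism k -> K})
      (phi : N -> K^o),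
    alg_point iota phi -> one_param_subgroup iota (exp_curve exp_comap phi);
  exp_commute : forall (K : fieldType) (iota : {rmorphism k -> K})
      (phi phi' : N -> K^o),
    alg_point iota phi -> alg_point iota phi' ->
    (forall f,
      lie_bracket (phi \o np_taut N) (phi' \o np_taut N) f = 0) ->
    forall (A : comAlgType K) (a b : A),
      conv (exp_curve exp_comap phi a) (exp_curve exp_comap phi' b) =1
      conv (exp_curve exp_comap phi' b) (exp_curve exp_comap phi a);
  exp_scale : forall (K : fieldType) (iota : {rmorphism k -> K})
      (phi phi' : N -> K^o) (alpha : K) (s : K^o),
    alg_point iota phi -> alg_point iota phi' ->
    (forall f, phi' (np_taut N f) = alpha *: phi (np_taut N f)) ->
    exp_curve exp_comap phi' s =1 exp_curve exp_comap phi (alpha *: s);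
  exp_all : forall (K : fieldType) (iota : {rmorphism k -> K})
      (psi : curve G K),
    one_param_subgroup iota psi ->
    exists r (phi : 'I_r -> N -> K^o),
      [/\ (0 < r)%N, commuting_tuple iota phi
        & forall (A : comAlgType K) (a : A),
            psi A a =1 exp_tuple exp_comap iota phi a];
  exp_infinitesimal : forall (K : fieldType) (iota : {rmorphism k -> K})
      (r : nat), (0 < r)%N ->
    [/\ forall phi : 'I_r -> N -> K^o, commuting_tuple iota phi ->
          inf_one_param_subgroup iota p r (exp_tuple exp_comap iota phi),
        forall phi phi' : 'I_r -> N -> K^o,
          commuting_tuple iota phi -> commuting_tuple iota phi' ->
          inf_eq p r (exp_tuple exp_comap iota phi)
                     (exp_tuple exp_comap iota phi') ->
          forall i, phi i =1 phi' i
      & forall psi : curve G K, inf_one_param_subgroup iota p r psi ->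
          exists2 phi : 'I_r -> N -> K^o, commuting_tuple iota phi
            & inf_eq p r psi (exp_tuple exp_comap iota phi)]
}.

(* G-modules, as right comodules over the coordinate algebra *)
Record gmodule (k : fieldType) (G : affine_group k) := GModule {
  gmod_space :> lmodType k;
  coact : {linear gmod_space -> tensor gmod_space G};
  coactA : forall m,
    tens_assoc (tens_map coact id (coact m)) = tens_map id (comul G) (coact m);
  coact1 : forall m, tens_lift (fun n f => counit G f *: n) (coact m) = m
}.

Section TensorModule.
Variables (k : fieldType) (G : affine_group k) (M N : gmodule G).

(* m ⊗ n |-> m_(0) ⊗ n_(0) ⊗ m_(1) n_(1) *)
Definition tens_coact : tensor M N -> tensor (tensor M N) G :=
  tens_lift (fun m n => tens_pair (@tens k M N) *%R (coact M m) (coact N n)).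

Lemma pair_bilin : bilin (tens_pair (@tens k M N) (@GRing.mul G)).
Proof. exact: tens_pair_bilin (tens_bilin _ _) (mul_bilin _). Qed.

Lemma coact_pair_bilin : bilin (fun m n =>
  tens_pair (@tens k M N) *%R (coact M m) (coact N n)).
Proof.
exact: bilin_comp pair_bilin (@linearP _ _ _ _ (coact M))
  (@linearP _ _ _ _ (coact N)) (@linear_id _ _).
Qed.

Fact tens_coact_lin : linear tens_coact.
Proof. exact/tens_lift_lin/coact_pair_bilin. Qed.

HB.instance Definition _ := GRing.isLinear.Build k (tensor M N)
  (tensor (tensor M N) G) *:%R tens_coact tens_coact_lin.

Lemma tens_coactE m n :
  tens_coact (m ⊗ n) = tens_pair (@tens k M N) *%R (coact M m) (coact N n).
Proof. exact/tens_liftE/coact_pair_bilin. Qed.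

Fact tens_coactA t :
  tens_assoc (tens_map tens_coact id (tens_coact t)) =
  tens_map id (comul G) (tens_coact t).
Proof.
have lT := tens_coact_lin; have lD := @linearP _ _ _ _ (comul G).
have lM := @linearP _ _ _ _ (coact M); have lN := @linearP _ _ _ _ (coact N).
have lI V := @linear_id k V.
have lA U V W := @tens_assoc_lin k U V W.
have lAt (U V W : lmodType k) (w : W) : linear (fun z : tensor U V => tens_assoc (z ⊗ w)).
  by move=> a x y; rewrite (tens_bilin _ _).1 lA.
pose T' := tens_pair (@tens k M N) (@tens_mul k G G).
have bT' : bilin T' := tens_pair_bilin (tens_bilin _ _) (tens_mul_bilin _ _).
pose T3 := tens_pair (tens_pair (@tens k M N) (@GRing.mul G)) (@GRing.mul G).
have bT3 : bilin T3 := tens_pair_bilin pair_bilin (mul_bilin _).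
have id_comul x y : tens_map id (comul G) (tens_pair (@tens k M N) *%R x y) =
    T' (tens_map id (comul G) x) (tens_map id (comul G) y).
  move: x y; apply: eq_bilin_tens => [||m f n g].
  - exact: bilin_comp pair_bilin (lI _) (lI _) (tens_map_lin (lI _) lD).
  - by apply: bilin_comp bT' _ _ (lI _); exact: tens_map_lin.
  rewrite tens_pairE; [|exact: tens_bilin|exact: mul_bilin].
  rewrite !tens_mapE // /T' tens_pairE; [|exact: tens_bilin|exact: tens_mul_bilin].
  by rewrite comulM.
have assoc_pair x y : tens_assoc (T3 x y) = T' (tens_assoc x) (tens_assoc y).
  move: x y; apply: eq_bilin_tens => [||x f y g].
  - exact: bilin_comp bT3 (lI _) (lI _) (lA _ _ _).
  - exact: bilin_comp bT' (lA _ _ _) (lA _ _ _) (lI _).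
  rewrite /T3 tens_pairE; [|exact: pair_bilin|exact: mul_bilin].
  move: x y; apply: eq_bilin_tens => [||m f' n g'].
  - exact: bilin_comp pair_bilin (lI _) (lI _) (lAt _ _ _ _).
  - exact: bilin_comp bT' (lAt _ _ _ _) (lAt _ _ _ _) (lI _).
  rewrite tens_pairE; [|exact: tens_bilin|exact: mul_bilin].
  rewrite !tens_assocE /T' tens_pairE; [|exact: tens_bilin|exact: tens_mul_bilin].
  by rewrite /tens_mul tens_pairE //; exact: mul_bilin.
have coact_id x y :
    tens_map tens_coact id (tens_pair (@tens k M N) *%R x y) =
    T3 (tens_map (coact M) id x) (tens_map (coact N) id y).
  move: x y; apply: eq_bilin_tens => [||m f n g].
  - exact: bilin_comp pair_bilin (lI _) (lI _) (tens_map_lin lT (lI _)).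
  - by apply: bilin_comp bT3 _ _ (lI _); exact: tens_map_lin.
  rewrite tens_pairE; [|exact: tens_bilin|exact: mul_bilin].
  rewrite !tens_mapE // tens_coactE /T3 tens_pairE //; first exact: pair_bilin.
  exact: mul_bilin.
move: t; apply: eq_linear_tens => [||m n].
- exact: linear_comp (lA _ _ _) (linear_comp (tens_map_lin lT (lI _)) lT).
- exact: linear_comp (tens_map_lin (lI _) lD) lT.
by rewrite tens_coactE id_comul coact_id assoc_pair !coactA.
Qed.

Lemma counit_bilin (V : lmodType k) :
  bilin (fun (n : V) (f : G) => counit G f *: n).
Proof.
split=> [f a x y|n a f g]; first by rewrite scalerDr !scalerA mulrC.
by rewrite linearP scalerDl scalerA.
Qed.

Fact tens_coact1 t :
  tens_lift (fun n f => counit G f *: n) (tens_coact t) = t.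
Proof.
have lI V := @linear_id k V.
pose E (V : lmodType k) : tensor V G -> V :=
  tens_lift (fun n f => counit G f *: n).
have lE V : linear (@E V) by exact/tens_lift_lin/counit_bilin.
have pair_counit x y : E _ (tens_pair (@tens k M N) *%R x y) = E _ x ⊗ E _ y.
  move: x y; apply: eq_bilin_tens => [||m f n g].
  - exact: bilin_comp pair_bilin (lI _) (lI _) (lE _).
  - exact: bilin_comp (tens_bilin _ _) (lE _) (lE _) (lI _).
  rewrite tens_pairE; [|exact: tens_bilin|exact: mul_bilin].
  rewrite /E !tens_liftE; try exact: counit_bilin.
  by rewrite tensZl tensZr scalerA rmorphM.
move: t; apply: eq_linear_tens => [||m n].
- exact: linear_comp (lE _) tens_coact_lin.
- exact: lI.
by rewrite tens_coactE -/(E _) pair_counit /E !coact1.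
Qed.

Definition tens_gmodule : gmodule G :=
  @GModule k G (tensor M N) tens_coact tens_coactA tens_coact1.

End TensorModule.

Section Submodules.
Variables (k : fieldType) (G : affine_group k) (M : gmodule G).

Definition subspace (V : lmodType k) (N : set V) : Prop :=
  N 0 /\ forall (a : k) x y, N x -> N y -> N (a *: x + y).

Definition coacts_in (N : set M) (X : set G) : Prop :=
  forall m, N m -> tens_sub N X (coact M m).

Definition submodule (N : set M) : Prop := subspace N /\ coacts_in N setT.

(* The largest submodule N with coefficients in X, defined as the union of all
   of them; the lemma below shows that it is the largest one. *)
Definition max_submodule (X : set G) : set M :=
  [set m | exists N : set M, [/\ submodule N, coacts_in N X & N m]].

Lemma tens_subS (U V : lmodType k) (A A' : set U) (X X' : set V) :
  A `<=` A' -> X `<=` X' -> tens_sub A X `<=` tens_sub A' X'.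
Proof.
move=> AA XX _ [s sAX ->]; exists s => // w /sAX [Aw Xw].
by split; [exact: AA|exact: XX].
Qed.

Lemma tens_subD (U V : lmodType k) (A : set U) (X : set V) a x y :
  subspace A -> tens_sub A X x -> tens_sub A X y -> tens_sub A X (a *: x + y).
Proof.
move=> [A0 Alin] [s sP ->] [t tP ->].
exists ([seq (a *: w.1, w.2) | w <- s] ++ t) => [w|].
  rewrite mem_cat => /orP[/mapP[w' /sP [Aw Xw] ->] /=|/tP//].
  by split=> //; rewrite -[_ *: _]addr0; exact: Alin.
rewrite big_cat big_map scaler_sumr /=; congr (_ + _).
by apply: eq_bigr => w _; rewrite tensZl.
Qed.

Lemma max_submoduleP (X : set G) :
  [/\ submodule (max_submodule X), coacts_in (max_submodule X) X
    & forall N, submodule N -> coacts_in N X -> N `<=` max_submodule X].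
Proof.
have maxS N : submodule N -> coacts_in N X -> N `<=` max_submodule X.
  by move=> Nsub NX m Nm; exists N.
have maxX : coacts_in (max_submodule X) X.
  move=> m [N [Nsub NX Nm]]; apply: tens_subS (NX m Nm) => //; exact: maxS.
split=> //; split; last by move=> m /maxX; exact: tens_subS.
split=> [|a x y [N [Nsub NX Nx]] [N' [N'sub N'X N'y]]].
  exists [set 0]; split=> //; last first.
    move=> m ->; exists [::] => //; by rewrite big_nil linear0.
  split; last by move=> m ->; exists [::] => //; rewrite big_nil linear0.
  by split=> // a x y -> ->; rewrite scaler0 addr0.
pose S := [set m | exists n n', [/\ N n, N' n' & m = n + n']].
have [[N0 Nlin] Nco] := Nsub; have [[N'0 N'lin] N'co] := N'sub.
have sNS : N `<=` S by move=> n Nn; exists n, 0; rewrite addr0.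
have sN'S : N' `<=` S by move=> n Nn; exists 0, n; rewrite add0r.
have Ssp : subspace S.
  split; first exact: sNS.
  move=> b _ _ [n [n' [Nn Nn' ->]]] [q [q' [Nq Nq' ->]]].
  exists (b *: n + q), (b *: n' + q'); split; [exact: Nlin|exact: N'lin|].
  by rewrite scalerDr addrACA.
have Sco Y : coacts_in N Y -> coacts_in N' Y -> coacts_in S Y.
  move=> NY N'Y _ [n [n' [Nn Nn' ->]]]; rewrite -[n]scale1r linearP.
  apply: tens_subD => //; first exact: tens_subS (NY n Nn).
  exact: tens_subS (N'Y n' Nn').
exists S; split; [by split=> //; exact: Sco|exact: Sco|].
exists (a *: x), y; split=> //.
by rewrite -[_ *: _]addr0; exact: Nlin.
Qed.

Definition filtration (F : nat -> set M) : Prop :=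
  [/\ forall d, submodule (F d), forall d, F d `<=` F d.+1
    & \bigcup_d F d = setT].

Definition subordinate (F F' : nat -> set M) : Prop :=
  forall d, F d `<=` F' d.

Definition coarsest_subordinate (F D : nat -> set M) : Prop :=
  [/\ filtration F, subordinate F D
    & forall F', filtration F' -> subordinate F' D -> subordinate F' F].

End Submodules.

Section ExponentialDegree.
Variables (p : nat) (k : fieldType) (G : affine_group k).
Variables (N : pnilp_variety p G) (e : exponential_type N).

(* The functions f whose image e f has degree at most d in t *)
Definition exp_coord (d : nat) : set G := [set f | (size (e f) <= d.+1)%N].

Definition exp_degree (M : gmodule G) (d : nat) : set M :=
  [set m | tens_sub setT (exp_coord d) (coact M m)].

End ExponentialDegree.

Arguments max_submodule {k G} M X.
Arguments exp_degree {p k G N} e M d.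

(* Main.v *)
Require Import Defs.
From HB Require Import structures.
From mathcomp Require Import all_boot all_order all_algebra.
From mathcomp Require Import boolp classical_sets.

Set Implicit Arguments.
Unset Strict Implicit.
Unset Printing Implicit Defensive.

Import GRing.Theory.
Local Open Scope ring_scope.
Local Open Scope classical_set_scope.

(** That the largest submodule with coefficients of degree at most d lies in
    the d-th step of the filtration by exponential degree is immediate, and the
    statement on tensor products holds because the exponential comorphism is
    multiplicative, so that degrees in t add up.  Two points remain, and both
    are linear algebra over the field k.

    Coarseness: a submodule A of M on which the coaction takes values in
    M ⊗ X also has its coaction in A ⊗ X, because
    (A ⊗ O(G)) ∩ (M ⊗ X) = A ⊗ X (lemma [tens_subI]).

    Exhaustion: the elements (id ⊗ phi)(coact m), with phi a functional on
    O(G), form a submodule containing m.  If coact m is the sum of the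
    m_i ⊗ f_i with independent f_i, each m_i has this form, and coassociativity
    expresses the coaction of (id ⊗ phi)(coact m) as the sum of the
    m_i ⊗ (id ⊗ phi)(comul f_i).  The second factors stay, as phi varies, in a
    finite-dimensional subspace of O(G), on which the exponential degree is
    bounded (lemma [generated_coacts_in]).

    Both points rest on [tens_sub_dual]: a tensor written with the least number of
    terms has linearly independent right factors, and contraction with dual
    functionals, whose existence in infinite dimension comes from Zorn's
    lemma, recovers its left factors. *)

(** * Linear maps, subspaces and functionals *)

Section LinearMaps.
Variables (k : fieldType) (U V : lmodType k) (f : U -> V).
Hypothesis f_lin : linear f.

Lemma lin0 : f 0 = 0.
Proof. by have := f_lin (-1) 0 0; rewrite !scaleN1r !addNr. Qed.

Lemma linD x y : f (x + y) = f x + f y.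
Proof. by have := f_lin 1 x y; rewrite !scale1r. Qed.

Lemma lin_sum (I : Type) (s : seq I) (F : I -> U) :
  f (\sum_(i <- s) F i) = \sum_(i <- s) f (F i).
Proof. by rewrite (big_morph f linD lin0). Qed.

End LinearMaps.

Section Functionals.
Variables (k : fieldType) (V : lmodType k).

Lemma subspaceZ (W : set V) a x : subspace W -> W x -> W (a *: x).
Proof. by move=> [W0 WP] Wx; rewrite -[_ *: _]addr0; exact: WP. Qed.

Lemma subspaceD (W : set V) x y : subspace W -> W x -> W y -> W (x + y).
Proof. by move=> [W0 WP] Wx Wy; rewrite -[x]scale1r; exact: WP. Qed.

Lemma subspace_sum (I : eqType) (W : set V) (s : seq I) (F : I -> V) :
  subspace W -> (forall i, i \in s -> W (F i)) -> W (\sum_(i <- s) F i).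
Proof.
move=> Wsub WF; rewrite big_seq; elim/big_ind: _ => //; first exact: Wsub.1.
by move=> x y; exact: subspaceD.
Qed.

(** A hyperplane complementary to the line of [x] and containing [W], obtained
    as a maximal subspace containing [W] but not [x]. *)
Lemma exists_hyperplane (W : set V) (x : V) : subspace W -> ~ W x ->
  exists H : set V, [/\ subspace H, W `<=` H, ~ H x
    & forall v, exists c, H (v - c *: x)].
Proof.
move=> Wsub Wx.
(* Zorn's lemma also applies to the empty chain, hence the union with [W]. *)
have [|A [[Asub Ax] Amax]] :=
  @Zorn_bigcup V [set H | subspace (W `|` H) /\ ~ (W `|` H) x].
  move=> F FP Ftot; split; last first.
    by move=> [//|[H /FP[_ Hx] xH]]; apply: Hx; right.
  split; first by left; exact: Wsub.1.
  have up H u : F H -> (W `|` H) u -> (W `|` \bigcup_(X in F) X) u.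
    by move=> FH [Wu|Hu]; [left|right; exists H].
  move=> a u v [Wu|[H FH Hu]] [Wv|[H' FH' Hv]].
  - by left; exact: Wsub.2.
  - apply: (up H') => //; apply: (FP _ FH').1.2; first by left.
    by right.
  - apply: (up H) => //; apply: (FP _ FH).1.2; last by left.
    by right.
  - case: (Ftot _ _ FH FH') => sub.
      apply: (up H') => //; apply: (FP _ FH').1.2; right=> //; exact: sub.
    apply: (up H) => //; apply: (FP _ FH).1.2; right=> //; exact: sub.
exists (W `|` A); split=> // v.
have [Hv|Hv] := pselect ((W `|` A) v); first by exists 0; rewrite scale0r subr0.
(* By maximality, the subspace spanned by the hyperplane and [v] contains [x]. *)
pose B := [set u | exists c, (W `|` A) (u - c *: v)].
have HB : W `|` A `<=` B by move=> u Hu; exists 0; rewrite scale0r subr0.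
have Bsub : subspace B.
  split; first by apply: HB; exact: Asub.1.
  move=> a u w [c Hu] [c' Hw]; exists (a * c + c').
  suff -> : a *: u + w - (a * c + c') *: v = a *: (u - c *: v) + (w - c' *: v).
    exact: Asub.2.
  by rewrite scalerBr scalerDl scalerA opprD addrACA.
have Bv : B v by exists 1; rewrite scale1r subrr; exact: Asub.1.
have WB : W `|` B = B by apply/setUidPr => u Wu; apply: HB; left.
have [c Hc] : B x.
  apply: contrapT => Bx; apply: (Amax B); last first.
    by rewrite /mkset WB; exact: conj.
  split=> [u Au|BA]; first by apply: HB; right.
  by apply: Hv; right; exact: BA.
have c0 : c != 0 by apply/eqP => c0; apply: Ax; rewrite c0 scale0r subr0 in Hc.
exists c^-1.
have -> : v - c^-1 *: x = - c^-1 *: (x - c *: v).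
  by rewrite scalerBr !scaleNr scalerA mulVf // scale1r opprK addrC.
exact: subspaceZ.
Qed.

(** The functional is the coordinate along [x] modulo such a hyperplane. *)
Lemma exists_functional (W : set V) (x : V) : subspace W -> ~ W x ->
  exists phi : V -> k^o, [/\ linear phi, phi x = 1 & forall w, W w -> phi w = 0].
Proof.
move=> Wsub /(exists_hyperplane Wsub)[H [Hsub WH Hx /choice[phi phiP]]].
have uniq v c : H (v - c *: x) -> phi v = c.
  move=> Hc; apply: contra_notP Hx => /eqP; rewrite -subr_eq0 => nz.
  have -> : x = (phi v - c)^-1 *: ((v - c *: x) - (v - phi v *: x)).
    have -> : (v - c *: x) - (v - phi v *: x) = (phi v - c) *: x.
      by rewrite opprB addrC addrA subrK scalerBl.
    by rewrite scalerA mulVf // scale1r.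
  apply: subspaceZ => //; apply: subspaceD => //.
  by rewrite -scaleN1r; exact: subspaceZ.
exists phi; split=> [a u v||w /WH Hw]; apply: uniq.
- suff -> : a *: u + v - (a * phi u + phi v) *: x
      = a *: (u - phi u *: x) + (v - phi v *: x) by exact: Hsub.2.
  by rewrite scalerBr scalerDl scalerA opprD addrACA.
- by rewrite scale1r subrr; exact: Hsub.1.
- by rewrite scale0r subr0.
Qed.

(** The linear span of a finite sequence of vectors. *)
Fixpoint span_seq (s : seq V) : set V :=
  if s is v :: s' then [set x | exists c, span_seq s' (x - c *: v)] else [set 0].

Lemma span_seq_subspace s : subspace (span_seq s).
Proof.
elim: s => [|v s [IH0 IH]] /=; first by split=> // a x y -> ->; rewrite scaler0 addr0.
split=> [|a x y [c xc] [d yd]]; first by exists 0; rewrite scale0r subr0.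
exists (a * c + d).
suff -> : a *: x + y - (a * c + d) *: v = a *: (x - c *: v) + (y - d *: v).
  exact: IH.
by rewrite scalerBr scalerDl scalerA opprD addrACA.
Qed.

Lemma mem_span_seq s v : v \in s -> span_seq s v.
Proof.
elim: s => //= w s IH; rewrite inE => /predU1P[->|/IH sv].
  by exists 1; rewrite scale1r subrr; exact: (span_seq_subspace s).1.
by exists 0; rewrite scale0r subr0.
Qed.

End Functionals.

(** * Contraction of tensors *)

Section Contraction.
Variable k : fieldType.

(** The map [id ⊗ phi] from [U ⊗ V] to [U] attached to a functional [phi] on
    [V]. *)
Definition contract (U V : lmodType k) (phi : V -> k^o) : tensor U V -> U :=
  tens_lift (fun u v => phi v *: u).

Section Theory.
Variables (U V : lmodType k) (phi : V -> k^o).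
Hypothesis phi_lin : linear phi.

Lemma contract_bilin : bilin (fun (u : U) v => phi v *: u).
Proof.
split=> [v a x y|u a x y]; first by rewrite scalerDr !scalerA mulrC.
by rewrite phi_lin scalerDl scalerA.
Qed.

Lemma contract_lin : linear (contract phi : tensor U V -> U).
Proof. exact/tens_lift_lin/contract_bilin. Qed.

Lemma contractE (u : U) (v : V) : contract phi (u ⊗ v) = phi v *: u.
Proof. exact/tens_liftE/contract_bilin. Qed.

Lemma contract_sum (s : seq (U * V)) :
  contract phi (\sum_(w <- s) w.1 ⊗ w.2) = \sum_(w <- s) phi w.2 *: w.1.
Proof.
by rewrite -tens_piE /contract tens_lift_pi //; exact/bilin_balanced/contract_bilin.
Qed.

End Theory.

Lemma contract_comb (U V : lmodType k) (phi psi : V -> k^o) a (t : tensor U V) :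
  contract (fun v => a *: phi v + psi v) t = a *: contract phi t + contract psi t.
Proof. by apply: tens_lift_comb => u v; rewrite scalerDl scalerA. Qed.

(** A tensor in [A ⊗ X] can be written with linearly independent right factors
    in [X].  The conclusion records what independence is needed for: contraction
    with a functional dual to a right factor yields the matching left factor. *)
Lemma tens_sub_dual (U V : lmodType k) (A : set U) (X : set V) t :
  subspace A -> tens_sub A X t ->
  exists s : seq (U * V), [/\ forall w, w \in s -> A w.1 /\ X w.2,
    t = \sum_(w <- s) w.1 ⊗ w.2
  & forall w, w \in s -> exists2 phi : V -> k^o, linear phi
      & contract phi t = w.1].
Proof.
move=> Asub [s0 s0P t0].
pose P n := `[< exists s : seq (U * V), [/\ size s = n,
  forall w, w \in s -> A w.1 /\ X w.2 & t = \sum_(w <- s) w.1 ⊗ w.2] >].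
have exP : exists n, P n by exists (size s0); apply/asboolP; exists s0.
have [n /asboolP[s [<- sP tE]] min] := ex_minnP exP.
exists s; split=> // w sw.
have [s1 [s2 sE]] : exists s1 s2, s = s1 ++ w :: s2.
  by case/splitPr: sw => s1 s2; exists s1, s2.
have tE' : t = \sum_(v <- w :: s1 ++ s2) v.1 ⊗ v.2.
  by rewrite tE sE big_cons !big_cat big_cons /= addrCA.
have s12P v : v \in s1 ++ s2 -> A v.1 /\ X v.2.
  move=> vs; apply: sP; rewrite sE mem_cat inE.
  by move: vs; rewrite mem_cat => /orP[] ->; rewrite ?orbT.
(* A dependent right factor can be absorbed by the other terms. *)
have absorb r u v : (forall w, w \in r -> A w.1 /\ X w.2) -> A u ->
    span_seq (map snd r) v ->
    exists r' : seq (U * V), [/\ size r' = size r,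
      forall w, w \in r' -> A w.1 /\ X w.2
    & u ⊗ v + \sum_(w <- r) w.1 ⊗ w.2 = \sum_(w <- r') w.1 ⊗ w.2].
  elim: r v => [|z r IH] v rP Au /=.
    move=> ->; exists [::]; rewrite big_nil addr0; split=> //.
    exact: lin0 ((tens_bilin U V).2 u).
  move=> [c /IH[|//|r' [sr' r'P r'E]]].
    by move=> w' w'r; apply: rP; rewrite inE w'r orbT.
  have [Az Xz] := rP z (mem_head _ _).
  exists ((z.1 + c *: u, z.2) :: r'); split=> [|w'|]; first by rewrite /= sr'.
    rewrite inE => /predU1P[-> /=|/r'P//]; split=> //.
    by rewrite addrC; exact: Asub.2.
  rewrite !big_cons -r'E /= tensDl tensZl -tensZr.
  rewrite -{1}[v](subrK (c *: z.2)) tensDr.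
  by rewrite [u ⊗ (v - _) + _]addrC addrACA [u ⊗ (c *: _) + _]addrC.
have [phi [phil phi1 phi0]] : exists phi : V -> k^o,
    [/\ linear phi, phi w.2 = 1
      & forall v, span_seq (map snd (s1 ++ s2)) v -> phi v = 0].
  apply: exists_functional; first exact: span_seq_subspace.
  move=> /(absorb _ w.1 _ s12P (sP _ sw).1)[r [szr rP rE]].
  have : (size s <= size r)%N.
    by apply: min; apply/asboolP; exists r; rewrite tE' big_cons rE.
  by rewrite szr sE !size_cat /= addnS ltnn.
exists phi => //; rewrite tE' contract_sum // big_cons phi1 scale1r.
rewrite big1_seq ?addr0 // => v vs; rewrite phi0 ?scale0r //.
exact/mem_span_seq/map_f.
Qed.

(** The intersection of [A ⊗ V] and [U ⊗ X] inside [U ⊗ V] is [A ⊗ X]. *)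
Lemma tens_subI (U V : lmodType k) (A : set U) (X : set V) t :
  subspace A -> tens_sub A setT t -> tens_sub setT X t ->
  tens_sub A X t.
Proof.
move=> Asub [r rA tr] /tens_sub_dual[//|s [sX ts dual]].
exists s => // w sw; split; last by have [] := sX w sw.
have [phi phil <-] := dual w sw.
rewrite tr contract_sum //; apply: subspace_sum => // v /rA[Av _].
exact: subspaceZ.
Qed.

End Contraction.

(** * The submodule generated by an element *)

Section Coefficients.
Variables (k : fieldType) (G : affine_group k) (M : gmodule G).

(** The subspace of all [(id ⊗ phi)(coact m)], the cyclic module generated by
    [m] over the dual algebra of the coordinate coalgebra. *)
Definition generated (m : M) : set M :=
  [set x | exists2 phi : G -> k^o, linear phi & x = contract phi (coact M m)].

Lemma generated_subspace m : subspace (generated m).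
Proof.
split.
  exists (fun=> 0); first by move=> a x y; rewrite scaler0 addr0.
  by rewrite /contract /tens_lift big1 // => w _; rewrite scale0r.
move=> a _ _ [phi phil ->] [psi psil ->].
exists (fun v => a *: phi v + psi v); last by rewrite contract_comb.
move=> b x y; rewrite phil psil !scalerDr !scalerA addrACA.
by rewrite [a * b]mulrC.
Qed.

Lemma mem_generated m : generated m m.
Proof.
exists (counit G : G -> k^o); first exact: linearP.
by rewrite /contract coact1.
Qed.

(** By coassociativity, if [coact m] is the sum of the [m_i ⊗ f_i], then the
    coaction sends [(id ⊗ phi)(coact m)] to the sum of the
    [m_i ⊗ (id ⊗ phi)(comul f_i)]. *)
Lemma coact_contract (phi : G -> k^o) m : linear phi ->
  coact M (contract phi (coact M m)) =
  tens_map id (contract phi) (tens_map id (comul G) (coact M m)).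
Proof.
move=> phil; rewrite -coactA.
have lM : linear (coact M) := @linearP _ _ _ _ (coact M).
have lI V := @linear_id k V.
have lC (U : lmodType k) : linear (@contract k U G phi) by exact: contract_lin.
have lA U V W : linear (@tens_assoc k U V W) by exact: tens_assoc_lin.
have contract_assoc (t : tensor (tensor M G) G) :
    contract phi t = tens_map id (contract phi) (tens_assoc t).
  move: t; apply: eq_linear_tens => [||t f].
  - exact: lC.
  - exact: linear_comp (tens_map_lin (lI _) (lC _)) (lA _ _ _).
  rewrite contractE //; move: t; apply: eq_linear_tens => [||m' g].
  - by move=> a x y; rewrite scalerDr !scalerA mulrC.
  - move=> a x y; rewrite (tens_bilin _ _).1 lA.
    exact: (tens_map_lin (lI _) (lC _)).
  rewrite tens_assocE tens_mapE //; last exact: lC.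
  by rewrite contractE // tensZr.
rewrite -contract_assoc; move: (coact M m); apply: eq_linear_tens => [||m' f].
- exact: linear_comp lM (lC _).
- exact: linear_comp (lC _) (tens_map_lin lM (lI _)).
by rewrite tens_mapE // !contractE // linearZ.
Qed.

End Coefficients.

(** * Exponential degree *)

Section ExponentialDegree.
Variables (p : nat) (k : fieldType) (G : affine_group k).
Variables (N : pnilp_variety p G) (e : exponential_type N).

Lemma exp_comap0 : e 0 = 0.
Proof. by have [eB _ _] := exp_comapP e; rewrite -(subrr 0) eB subrr. Qed.

Lemma exp_coord_subspace d : subspace (exp_coord e d).
Proof.
have [eB [_ eM] eC] := exp_comapP e.
have eN x : e (- x) = - e x by rewrite -sub0r eB exp_comap0 sub0r.
split=> [|a x y xd yd]; rewrite /exp_coord /=.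
  by rewrite exp_comap0 size_poly0.
rewrite -[y]opprK eB eN opprK -mulr_algl eM eC mul_polyC.
apply: leq_trans (size_polyD _ _) _; rewrite geq_max yd andbT.
exact: leq_trans (size_scale_leq _ _) xd.
Qed.

Lemma exp_coordS d d' : (d <= d')%N -> exp_coord e d `<=` exp_coord e d'.
Proof. by move=> dd' f /leq_trans; apply. Qed.

Lemma exp_coordM d d' f g : exp_coord e d f -> exp_coord e d' g ->
  exp_coord e (d + d') (f * g).
Proof.
have [_ [_ eM] _] := exp_comapP e => fd gd; rewrite /exp_coord /= eM.
apply: leq_trans (size_polyMleq _ _) _.
by rewrite -subn1 leq_subLR add1n -addnS -addSn leq_add.
Qed.

(** Contracting a fixed tensor with all functionals yields functions of
    bounded exponential degree. *)
Lemma contract_exp_coord (t : tensor G G) :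
  exists d, forall phi : G -> k^o, linear phi -> exp_coord e d (contract phi t).
Proof.
elim/(@tens_ind k): t => [|f g|x y [d xd] [d' yd']].
- exists 0%N => phi phil.
  rewrite lin0; last exact: contract_lin.
  exact: (exp_coord_subspace _).1.
- exists (size (e f)) => phi phil; rewrite contractE //.
  by apply: subspaceZ; [exact: exp_coord_subspace|exact: leqnSn].
exists (maxn d d') => phi phil.
rewrite linD; last exact: contract_lin.
apply: subspaceD; first exact: exp_coord_subspace.
  exact: exp_coordS (leq_maxl _ _) _ (xd _ phil).
exact: exp_coordS (leq_maxr _ _) _ (yd' _ phil).
Qed.

(** Local finiteness: the subspace [generated m] is a submodule, and its
    coefficients have bounded exponential degree. *)
Lemma generated_coacts_in (M : gmodule G) (m : M) :
  exists d, coacts_in (generated m) (exp_coord e d).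
Proof.
have setT_sub (V : lmodType k) : subspace [set: V] by split.
have [s [_ ms dual]] : exists s : seq (M * G),
    [/\ forall w, w \in s -> [set: M] w.1 /\ [set: G] w.2,
      coact M m = \sum_(w <- s) w.1 ⊗ w.2
    & forall w, w \in s -> exists2 phi : G -> k^o, linear phi
        & contract phi (coact M m) = w.1].
  apply: tens_sub_dual => //.
  by exists (repr (coact M m)) => //; rewrite -tens_piE reprK.
have [d dP] : exists d, forall w, w \in s -> forall phi : G -> k^o, linear phi ->
    exp_coord e d (contract phi (comul G w.2)).
  elim: s {ms dual} => [|w s [d dP]]; first by exists 0%N.
  have [d' d'P] := contract_exp_coord (comul G w.2).
  exists (maxn d d') => v; rewrite inE => /predU1P[->|vs] phi phil.
    exact: exp_coordS (leq_maxr _ _) _ (d'P _ phil).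
  exact: exp_coordS (leq_maxl _ _) _ (dP _ vs _ phil).
exists d => _ [phi phil ->]; rewrite coact_contract //.
exists [seq (w.1, contract phi (comul G w.2)) | w <- s].
  move=> _ /mapP[w sw ->] /=; split; last exact: dP.
  by have [psi psil <-] := dual w sw; exists psi.
have lD := @linearP _ _ _ _ (comul G); have lI := @linear_id k M.
have lC := contract_lin phil (U := G).
rewrite ms big_map (lin_sum (tens_map_lin lI lD)) (lin_sum (tens_map_lin lI lC)).
by apply: eq_bigr => w _; rewrite !tens_mapE.
Qed.

Lemma max_submodule_filtration (M : gmodule G) :
  filtration (fun d => max_submodule M (exp_coord e d)).
Proof.
split=> [d|d|]; first by have [] := @max_submoduleP k G M (exp_coord e d).
  move=> m [A [Asub AX Am]]; exists A; split=> // x /AX.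
  by apply: tens_subS => //; exact: exp_coordS.
apply/seteqP; split=> // m _; have [d dP] := generated_coacts_in m.
exists d => //; exists (generated m); split=> //; last exact: mem_generated.
split; first exact: generated_subspace.
by move=> x /dP; exact: tens_subS.
Qed.

Lemma max_submodule_tens (M M' : gmodule G) (d d' : nat) :
  tens_sub (max_submodule M (exp_coord e d))
           (max_submodule M' (exp_coord e d')) `<=`
  max_submodule (tens_gmodule M M') (exp_coord e (d + d')).
Proof.
have [[Asub _] AX _] := @max_submoduleP k G M (exp_coord e d).
have [_ A'X _] := @max_submoduleP k G M' (exp_coord e d').
move: (max_submodule M _) (max_submodule M' _) Asub AX A'X => A A' Asub AX A'X.
have Ssub : subspace (tens_sub A A').
  split; first by exists [::] => //; rewrite big_nil.
  by move=> a x y; exact: tens_subD.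
have SX : @coacts_in k G (tens_gmodule M M') (tens_sub A A') (exp_coord e (d + d')).
  move=> _ [s sP ->]; rewrite linear_sum.
  have Tsub : subspace (tens_sub (tens_sub A A') (exp_coord e (d + d'))).
    split; first by exists [::] => //; rewrite big_nil.
    by move=> a x y; exact: tens_subD.
  apply: subspace_sum => // -[m n] /sP[/= /AX[r rP mr] /A'X[r' r'P nr']].
  have bP := @pair_bilin k G M M'.
  rewrite [X in tens_sub _ _ X]tens_coactE mr nr' (lin_sum (bP.1 _)).
  apply: subspace_sum => // w /rP[Aw Xw]; rewrite (lin_sum (bP.2 _)).
  apply: subspace_sum => // w' /r'P[Aw' Xw'].
  rewrite tens_pairE; [|exact: tens_bilin|exact: mul_bilin].
  exists [:: (w.1 ⊗ w'.1, w.2 * w'.2)]; last by rewrite big_seq1.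
  move=> z; rewrite inE => /eqP -> /=; split; last exact: exp_coordM.
  exists [:: (w.1, w'.1)]; last by rewrite big_seq1.
  by move=> y; rewrite inE => /eqP ->.
move=> t St; exists (tens_sub A A'); split=> //; split=> // x /SX.
exact: tens_subS.
Qed.

End ExponentialDegree.

Theorem proposition2p11 (k : fieldType) (p : nat) (hp : p \in [pchar k])
    (G : affine_group k) (hG : linear_algebraic_group G)
    (N : pnilp_variety p G) (e : exponential_type N) :
  (forall M : gmodule G,
     coarsest_subordinate (fun d => max_submodule M (exp_coord e d))
                          (exp_degree e M)) /\
  (forall (M M' : gmodule G) (d d' : nat),
     tens_sub (max_submodule M (exp_coord e d))
              (max_submodule M' (exp_coord e d')) `<=`
     max_submodule (tens_gmodule M M') (exp_coord e (d + d'))).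
Proof.
split=> [M|M M' d d']; last exact: max_submodule_tens.
split=> [|d m [A [_ AX /AX]]|F' [F'sub _ _] F'D d m F'm].
- exact: max_submodule_filtration.
- exact: tens_subS.
exists (F' d); split=> // x F'x; have [Fsub Fco] := F'sub d.
apply: tens_subI; [by case: Fsub|exact: Fco|exact: F'D].
Qed.
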